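(* Let $d$ be a constant (a positive integer) and let $G$ be a random $d$-regular graph on $n$ vertices. Then, almost surely, $$\mathrm{boolw}(G)=\Omega\left(\frac{n}{d}\right);$$ that is, there is an absolute constant $c>0$ such that, for every constant $d$, $\Pr\left[\mathrm{boolw}(G)\ge c\,\frac{n}{d}\right]\to 1$ as $n\to\infty$.
   Context: Graphs are undirected and without loops. A random $d$-regular graph on $n$ vertices is chosen uniformly among the $d$-regular graphs on $n$ vertices, with $n$ ranging over values for which $dn$ is even. For a vertex subset $A\subseteq V(G)$ let $\overline{A}=V(G)\setminus A$, and for $X\subseteq A$ consider the set $N(X)\cap\overline{A}$ of vertices of $\overline{A}$ having at least one neighbor in $X$. Define $$\mathrm{cutbool}(A)=\log_2\left|\{N(X)\cap\overline{A} : X\subseteq A\}\right| ,$$ which is known to be symmetric: $\mathrm{cutbool}(A)=\mathrm{cutbool}(\overline{A})$. A decomposition tree of $G$ is a pair $(T,\delta)$ where $T$ is a tree whose internal nodes all have degree three and which has $|V(G)|$ leaves, and $\delta$ is a bijection between $V(G)$ and the leaves of $T$. Each edge of $T$ defines a cut $\{A,\overline{A}\}$ of $G$: the two parts are the vertices corresponding to the leaves of the two subtrees obtained by removing the edge. The boolean-width $\mathrm{boolw}(T,\delta)$ of the decomposition tree is the maximum of $\mathrm{cutbool}(A)$ over all cuts $\{A,\overline{A}\}$ given by edges of $T$. The boolean-width $\mathrm{boolw}(G)$ is the minimum of $\mathrm{boolw}(T,\delta)$ over all decomposition trees of $G$. ''Almost surely'' means with probability tending to $1$ as $n\to\infty$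.
   Formalization: The theorem is stated for d ≥ 3 instead of every positive integer d: for d = 1 and d = 2 the graph is a disjoint union of edges or of cycles, its boolean-width is at most 2, and the claim is false. *)

(* Defs.v *)
From HB Require Import structures.
From mathcomp Require Import all_boot all_order all_algebra.
From mathcomp Require Import all_classical all_reals all_analysis.
Set Implicit Arguments.
Unset Strict Implicit.
Unset Printing Implicit Defensive.
Import Order.TTheory GRing.Theory Num.Theory.
Import numFieldNormedType.Exports.
Local Open Scope ring_scope.

(* Boolean conditions make [sgraph V] a subtype of a finite type, so that
   labelled graphs on V can be counted. *)
Definition simple_adj (V : finType) (E : {set V * V}) : bool :=
  [forall x, forall y, ((x, y) \in E) == ((y, x) \in E)]
  && [forall x, (x, x) \notin E].

Record sgraph (V : finType) :=
  SGraph { adj_set : {set V * V}; adj_setP : simple_adj adj_set }.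

HB.instance Definition _ (V : finType) := [isSub for @adj_set V].
#[hnf] HB.instance Definition _ (V : finType) := [Countable of sgraph V by <:].
#[hnf] HB.instance Definition _ (V : finType) := [Finite of sgraph V by <:].

Definition adj (V : finType) (G : sgraph V) : rel V :=
  fun x y => (x, y) \in adj_set G.
Coercion adj : sgraph >-> rel.

Definition deg (V : finType) (G : sgraph V) (x : V) : nat :=
  #|[pred y | G x y]|.

Definition nbhd (V : finType) (G : sgraph V) (X : {set V}) : {set V} :=
  [set y : V | [exists x in X, G x y]]%SET.

Definition log2 (R : realType) (x : R) : R := ln x / ln 2.

Definition cutbool (R : realType) (V : finType) (G : sgraph V) (A : {set V}) : R :=
  log2 #|[set (nbhd G X :&: ~: A)%SET | X in powerset A]%SET|%:R.

Definition is_tree (T : finType) (G : sgraph T) : Prop :=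
  [/\ (0 < #|T|)%N,
      forall x y, connect G x y
    & forall p : seq T, ucycle G p -> (size p < 3)%N].

(* Degree 0 only occurs in the one-vertex tree, which is the decomposition tree
   of a one-vertex graph. *)
Definition is_leaf (T : finType) (G : sgraph T) (t : T) : bool :=
  (deg G t <= 1)%N.

Record decomp_tree (V : finType) := DecompTree {
  dt_node : finType;
  dt_graph : sgraph dt_node;
  dt_treeP : is_tree dt_graph;
  dt_cubicP : forall t, ~~ is_leaf dt_graph t -> deg dt_graph t = 3%N;
  dt_map : V -> {t : dt_node | is_leaf dt_graph t};
  dt_mapP : bijective dt_map }.

Definition del_edge (T : finType) (G : sgraph T) (s t : T) : rel T :=
  fun x y => G x y && ([set x; y]%SET != [set s; t]%SET).

Definition dt_cut (V : finType) (D : decomp_tree V) (s t : dt_node D) : {set V} :=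
  [set x : V | connect (del_edge (dt_graph D) s t) s (val (dt_map D x))]%SET.

(* Each edge is visited in both directions, hence both sides of each cut are;
   the default 0 only matters for the tree without edges, as cutbool >= 0. *)
Definition dt_boolw (R : realType) (V : finType) (G : sgraph V)
    (D : decomp_tree V) : R :=
  \big[Num.max/0]_(e : dt_node D * dt_node D | dt_graph D e.1 e.2)
    cutbool R G (dt_cut e.1 e.2).

(* The infimum is a minimum when V is nonempty: cutbool takes finitely many
   values. *)
Definition boolw (R : realType) (V : finType) (G : sgraph V) : R :=
  inf [set w | exists D : decomp_tree V, w = dt_boolw R G D]%classic.

Definition regular_graphs (d n : nat) : {set sgraph 'I_n} :=
  [set G : sgraph 'I_n | [forall x, deg G x == d]]%SET.

(* Probability under the uniform distribution on [regular_graphs d n];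
   it is 0 by convention when there is no such graph. *)
Definition regular_pr (R : realType) (d n : nat) (P : pred (sgraph 'I_n)) : R :=
  #|[set G in regular_graphs d n | P G]%SET|%:R / #|regular_graphs d n|%:R.

(* Main.v *)
Require Import Defs.
From mathcomp Require Import all_boot all_order all_algebra.
From mathcomp Require Import all_classical all_reals all_analysis.
From mathcomp Require Import zify ring lra fintype finset.
Import Order.TTheory GRing.Theory Num.Theory.
Import numFieldNormedType.Exports.
Set Implicit Arguments.
Unset Strict Implicit.
Unset Printing Implicit Defensive.
Local Open Scope ring_scope.

(** The proof bounds the boolean-width from below by vertex expansion, and gets
    the expansion of almost all regular graphs by switching edges.

    A decomposition tree of a graph on [n] vertices has an edge whose cut [A]
    is balanced, [n / 3 <= #|A| <= 2 n / 3] ([balanced_edge]). A minimal subset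
    of [A] that dominates the outer boundary of [A] has a private neighbour
    for each of its vertices, so that all its subsets leave different traces
    outside [A]; when the degrees are at most [d] this gives
    [cutbool A >= #|boundary A| / d] ([cutbool_ge]). It remains to prove that,
    with probability tending to [1], no balanced [A] has a boundary [S] of at
    most [n / 700] vertices. The infimum defining [boolw] must also be taken
    over a nonempty set, whence the caterpillar ([decomp_tree_exists]), and
    the probability needs a nonempty sample space, whence circulant graphs
    ([regular_graph_exists]).

    Fix [A] and [S], and let [B] be the set of all other vertices, so that a
    bad graph has no edge between [A] and [B]. Replacing an edge [a1 a2] inside
    [A] and an edge [b1 b2] inside [B] by [a1 b1] and [a2 b2] preserves the
    degrees and creates two crossing edges. Counting such switchings from both
    ends compares the numbers [N k] of [d]-regular graphs with [2 k] crossing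
    edges: as [d >= 3] and [S] is small, at least about [3 / 2 * #|A| - k] edges
    lie inside [A], and similarly for [B], which yields
    [16 * k.+1 ^ 2 * N k.+1 >= 25 * (#|A| - k) * (#|B| - k) * N k]
    ([switching_step]). Multiplying the steps up,
    [25 ^ K * 'C(#|A|, K) * 'C(#|B|, K) * N 0 <= 16 ^ K * N] for every [K],
    where [N] counts all the [d]-regular graphs ([card_no_crossing_le]).

    By Vandermonde's identity some [K >= n / 12] makes
    ['C(#|A|, K) * 'C(#|B|, K)] as large as the number of choices of [A] for
    the given [S] and [#|A|], up to a factor [n + 1]. The remaining factor
    [(16 / 25) ^ K] beats the number of sets [S], as these have at most
    [n / 700] elements, and the union bound ([card_badly_separated]) leaves a
    proportion of bad graphs of at most [(n + 1) ^ 2 * (100 / 101) ^ n]. *)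

(** * Boolean dimension of a cut *)

Lemma card_bigcup_le (I T : finType) (P : pred I) (F : I -> {set T}) :
  (#|\bigcup_(i | P i) F i| <= \sum_(i | P i) #|F i|)%N.
Proof.
elim/big_rec2: _ => [|i n A _ leAn]; first by rewrite cards0.
by rewrite (leq_trans (leq_card_setU _ _))// leq_add2l.
Qed.

Lemma card_nbhd (V : finType) (G : sgraph V) (d : nat) (X : {set V}) :
  (forall x, deg G x <= d)%N -> (#|nbhd G X| <= d * #|X|)%N.
Proof.
move=> degG.
have -> : nbhd G X = (\bigcup_(x in X) [set y | G x y])%SET.
  apply/setP=> y; rewrite inE; apply/existsP/bigcupP.
    by case=> x /andP[xX Gxy]; exists x; rewrite ?inE.
  by case=> x xX; rewrite inE => Gxy; exists x; rewrite xX.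
apply: (leq_trans (card_bigcup_le _ _)).
rewrite mulnC -sum_nat_const; apply: leq_sum => x _.
by rewrite cardsE; apply: degG.
Qed.

Lemma nbhdP (V : finType) (G : sgraph V) (X : {set V}) (y : V) :
  reflect (exists2 x, x \in X & G x y) (y \in nbhd G X).
Proof.
rewrite inE; apply: (iffP existsP) => -[x].
  by case/andP; exists x.
by move=> xX Gxy; exists x; rewrite xX.
Qed.

(** In a minimal subset [X] of [A] dominating the outer boundary of [A], every
    vertex has a private neighbour outside [A], so the [2 ^ #|X|] subsets of [X]
    have different traces; and [d * #|X|] bounds the boundary. *)
Lemma card_cut_traces (V : finType) (G : sgraph V) (d : nat) (A : {set V}) :
  (forall x, deg G x <= d)%N ->
  exists2 k, (#|nbhd G A :&: ~: A| <= d * k)%N &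
    (2 ^ k <= #|[set (nbhd G X :&: ~: A)%SET | X in powerset A]|)%N.
Proof.
move=> degG.
pose dominating (X : {set V}) :=
  (X \subset A) && (nbhd G X :&: ~: A == nbhd G A :&: ~: A)%SET.
have domA : dominating A by rewrite /dominating subxx eqxx.
pose X := [arg min_(X < A | dominating X) #|X|].
have [XA domX minX] : [/\ X \subset A,
    (nbhd G X :&: ~: A = nbhd G A :&: ~: A)%SET &
    forall Y, dominating Y -> (#|X| <= #|Y|)%N].
  by rewrite /X; case: arg_minnP => // Y /andP[YA /eqP domY] minY.
have private x : x \in X -> exists2 y, y \notin A &
    G x y /\ forall z, z \in X -> G z y -> z = x.
  move=> xX; have : ~~ dominating (X :\ x)%SET.
    apply: contraL (xX) => /minX; rewrite (cardsD1 x X).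
    by case: (x \in X); rewrite // ltnn.
  rewrite /dominating (subset_trans (subD1set _ _) XA)/= -domX => neq.
  have /subsetPn[y] : ~~ (nbhd G X :&: ~: A \subset nbhd G (X :\ x) :&: ~: A)%SET.
    apply: contra neq => sub; rewrite eqEsubset sub andbT.
    apply/subsetP => y /setIP[/nbhdP[z /setD1P[_ zX] Gzy] yA].
    by rewrite inE yA andbT; apply/nbhdP; exists z.
  rewrite !in_setI in_setC => /andP[/nbhdP[z zX Gzy] yA].
  rewrite yA andbT => noD.
  have only w : w \in X -> G w y -> w = x.
    move=> wX Gwy; apply: contraNeq noD => wx.
    by apply/nbhdP; exists w => //; rewrite !inE wx.
  by exists y => //; split=> //; rewrite -(only z zX Gzy).
exists #|X|; first by rewrite -domX (leq_trans (subset_leq_card (subsetIl _ _))) ?card_nbhd.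
have half (Y Z : {set V}) : Y \subset X -> Z \subset X ->
    (nbhd G Y :&: ~: A = nbhd G Z :&: ~: A)%SET -> Y \subset Z.
  move=> YX ZX eqYZ; apply/subsetP => x xY.
  have [y yA [Gxy only]] := private x (subsetP YX _ xY).
  have : y \in (nbhd G Y :&: ~: A)%SET.
    by rewrite in_setI in_setC yA andbT; apply/nbhdP; exists x.
  rewrite eqYZ => /setIP[/nbhdP[z zZ Gzy] _].
  by rewrite -(only z (subsetP ZX _ zZ) Gzy).
have inj : {in powerset X &, injective (fun Y => nbhd G Y :&: ~: A)%SET}.
  move=> Y Z; rewrite !powersetE => YX ZX eqYZ.
  by apply/eqP; rewrite eqEsubset (half Y Z YX ZX eqYZ) (half Z Y ZX YX (esym eqYZ)).
rewrite -card_powerset -(card_in_imset inj).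
apply/subset_leq_card/imsetS/subsetP => Y; rewrite !powersetE => YX.
exact: subset_trans YX XA.
Qed.

Lemma cutbool_ge (R : realType) (V : finType) (G : sgraph V) (d : nat)
    (A : {set V}) :
  (0 < d)%N -> (forall x, deg G x <= d)%N ->
  #|(nbhd G A :&: ~: A)%SET|%:R / d%:R <= cutbool R G A.
Proof.
move=> d0 /(card_cut_traces A)[k le_dk le_k].
rewrite ler_pdivrMr ?ltr0n// (@le_trans _ _ (k%:R * d%:R))//.
  by rewrite -natrM ler_nat mulnC.
rewrite ler_wpM2r// /cutbool /log2 ler_pdivlMr ?ln_gt0 ?ltr1n//.
rewrite mulrC mulr_natr -lnXn ?ltr0n// -natrX ler_ln ?posrE ?ltr0n ?expn_gt0//.
  by rewrite ler_nat.
by apply: leq_trans le_k; rewrite expn_gt0.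
Qed.

(** * A balanced edge of a decomposition tree *)

Lemma adj_sym (T : finType) (G : sgraph T) (x y : T) : G x y = G y x.
Proof. by have /andP[/forallP/(_ x)/forallP/(_ y)/eqP] := adj_setP G. Qed.

Lemma adj_irr (T : finType) (G : sgraph T) (x : T) : G x x = false.
Proof. by apply: negbTE; have /andP[_ /forallP/(_ x)] := adj_setP G. Qed.

Section Trees.
Variables (T : finType) (G : sgraph T).

(** A simple path leaving [s] never returns to [s]. *)
Lemma connect_first_step (e : rel T) (s x : T) :
  x != s -> connect e s x ->
  exists2 y, e s y &
    connect (fun u v => [&& e u v, u != s & v != s]) y x.
Proof.
move=> xs /connectP[p0 /shortenP[p path_p uniq_p _] x_last].
case: p => [|y p] in path_p uniq_p x_last *; first by rewrite x_last eqxx in xs.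
move: path_p uniq_p => /= /andP[esy path_p] /andP[s_notin _].
exists y => //; apply/connectP; exists p => //.
apply: (sub_in_path (P := fun z => z \in y :: p) _ _ path_p); last exact/allP.
move=> u v uyp vyp -> /=.
by apply/andP; split; apply: contraNneq s_notin => <-.
Qed.

Definition side (s t : T) : {set T} := [set x | connect (del_edge G s t) s x]%SET.

Lemma del_edge_sym (s t x y : T) : del_edge G s t x y = del_edge G t s x y.
Proof. by rewrite /del_edge [[set s; t]%SET]setUC. Qed.

Lemma del_edge_away (s t x y : T) :
  G x y -> x != s -> y != s -> del_edge G s t x y.
Proof.
move=> Gxy xs ys; rewrite /del_edge Gxy /=.
apply/negP => /eqP/setP/(_ s).
by rewrite !inE eqxx/= !(eq_sym s) (negbTE xs) (negbTE ys).
Qed.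

(** The path followed by the edge [s t] would be a cycle. *)
Lemma tree_edge_is_bridge (s t : T) :
  is_tree G -> G s t -> t \notin side s t.
Proof.
move=> [_ _ acyclic] Gst; rewrite inE; apply/negP.
move=> /connectP[p0 /shortenP[p path_p uniq_p _] t_last].
have /acyclic : ucycle G (s :: p).
  rewrite /ucycle uniq_p andbT /= rcons_path -t_last adj_sym Gst andbT.
  by apply: sub_path path_p => u v /andP[].
case: p => [|y [|//]] in path_p uniq_p t_last *.
  by rewrite t_last adj_irr in Gst.
by move: path_p; rewrite t_last/= /del_edge eqxx andbF.
Qed.

Lemma tree_edge_sides (s t x : T) :
  is_tree G -> G s t -> (x \in side s t) || (x \in side t s).
Proof.
move=> [_ conn _] Gst; rewrite !inE.
have [-> | xs] := eqVneq x s; first by rewrite connect0.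
have [y Gsy yx] := connect_first_step xs (conn s x).
have [<- | yt] := eqVneq y t.
  apply/orP; right; apply: connect_sub yx => u v /and3P[Guv us vs].
  by apply: connect1; rewrite del_edge_sym del_edge_away.
apply/orP; left; apply: connect_trans (_ : connect _ s y) _.
  apply: connect1; rewrite del_edge_sym del_edge_away// ?(eq_sym s) //.
  by apply: contraTneq Gst => ->; rewrite adj_irr.
apply: connect_sub yx => u v /and3P[Guv us vs].
by apply: connect1; rewrite del_edge_away.
Qed.

(** The branches at [s] other than the one behind the edge [s t] cover the side
    of [s], apart from [s]; they are the sides of the edges from [s] to its other neighbours. *)
Lemma side_step (s t x : T) :
  x \in side s t -> x != s -> exists2 y, G s y && (y != t) & x \in side y s.
Proof.
rewrite inE => sx xs.
have [y /andP[Gsy yt] yx] := connect_first_step xs sx.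
exists y.
  by rewrite Gsy; apply: contraNneq yt => ->.
rewrite inE; apply: connect_sub yx => u v /and3P[/andP[Guv _] us vs].
by apply: connect1; rewrite del_edge_sym del_edge_away.
Qed.

(** As the edge [s y] is a bridge, paths behind it avoid [s], hence also the edge
    [s t]. *)
Lemma side_proper (s t y : T) :
  is_tree G -> G s y -> y != t -> side y s \proper side s t.
Proof.
move=> treeG Gsy yt; have s_notin : s \notin side y s.
  by apply: tree_edge_is_bridge => //; rewrite adj_sym.
have s_in : s \in side s t by rewrite inE connect0.
rewrite properE; apply/andP; split; last by apply/subsetPn; exists s.
have ys : y != s by apply: contraTneq Gsy => ->; rewrite adj_irr.
apply/subsetP => x; rewrite inE => /connectP[p path_p ->].
rewrite inE; apply: (@connect_trans _ _ y).
  apply: connect1; rewrite /del_edge Gsy /=.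
  apply: contraNneq yt => /setP/(_ y); rewrite !inE eqxx orbT (negbTE ys)/=.
  by move=> /esym.
apply/connectP; exists p => //.
apply: (sub_in_path (P := fun z => z \in y :: p) _ _ path_p); last exact/allP.
have away z : z \in y :: p -> z != s.
  move=> zp; apply: contraNneq s_notin => zs.
  by rewrite inE -{2}zs; apply: path_connect zp.
by move=> u v /away us /away vs /andP[Guv _]; rewrite del_edge_away.
Qed.
End Trees.

Section BalancedEdge.
Variables (V : finType) (D : decomp_tree V).
Let G := dt_graph D.

Lemma mem_dt_cut (s t : dt_node D) (x : V) :
  (x \in dt_cut s t) = (val (dt_map D x) \in side G s t).
Proof. by rewrite !inE. Qed.

Lemma card_dt_cut_leaf (s t : dt_node D) :
  is_leaf G s -> G s t -> (#|dt_cut s t| <= 1)%N.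
Proof.
move=> leaf_s Gst; rewrite -(cards1 s).
have inj : injective (fun x => val (dt_map D x)).
  by move=> x y /val_inj; apply/bij_inj/dt_mapP.
rewrite -(card_imset _ inj); apply/subset_leq_card/subsetP => _ /imsetP[x xcut ->].
rewrite mem_dt_cut in xcut; rewrite inE; apply: contraTT xcut => xs.
apply/negP => /side_step/(_ xs)[y /andP[Gsy yt] _].
move: leaf_s; rewrite /is_leaf /deg leqNgt => /negP; apply.
have <- : #|[set y; t]%SET| = 2%N by rewrite cards2 yt.
apply/subset_leq_card/subsetP => z; rewrite !inE.
by case/orP => /eqP ->.
Qed.

Lemma card_dt_cut_split (s t : dt_node D) :
  ~~ is_leaf G s -> G s t ->
  exists2 y, G s y && (y != t) & (#|dt_cut s t| <= (#|dt_cut y s|).*2)%N.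
Proof.
move=> inner_s Gst; have deg3 := dt_cubicP inner_s.
have /cards2P[u [v [_ uv]]] : #|[set y | G s y]%SET :\ t| == 2%N.
  have := cardsD1 t [set y | G s y]%SET.
  by rewrite inE Gst cardsE -[#|_|]/(deg G s) deg3 add1n => /eqP; rewrite eqSS eq_sym.
have cover : dt_cut s t \subset (dt_cut u s :|: dt_cut v s)%SET.
  apply/subsetP => x; rewrite in_setU !mem_dt_cut => xs.
  have [|y /andP[Gsy yt] yx] := side_step xs.
    by apply: contraNneq inner_s => <-; apply: valP.
  have : y \in [set u; v]%SET by rewrite -uv !inE yt.
  by case/set2P => <-; rewrite yx ?orbT.
have uN : G s u && (u != t) by have := set21 u v; rewrite -uv !inE andbC.
have vN : G s v && (v != t) by have := set22 u v; rewrite -uv !inE andbC.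
have := leq_trans (subset_leq_card cover) (leq_card_setU _ _).
have [uv_le | /ltnW vu_le] := leqP #|dt_cut u s| #|dt_cut v s| => le_cut.
  by exists v; rewrite // -addnn (leq_trans le_cut)// leq_add2r.
by exists u; rewrite // -addnn (leq_trans le_cut)// leq_add2l.
Qed.

(** Among the edges whose first side carries at least a third of the vertices, one
    with a smallest such side is balanced: were it to carry more than two
    thirds, its end would have degree three and one of the two branches behind
    it would still carry more than a third. *)
Lemma balanced_edge :
  (1 < #|V|)%N ->
  exists s t, [/\ G s t, (#|V| <= 3 * #|dt_cut s t|)%N
                & (3 * #|dt_cut s t| <= 2 * #|V|)%N].
Proof.
set n := #|V| => n_gt1; have treeG := dt_treeP D.
have [s0 [t0 [Gst0 big0]]] : exists s t, G s t /\ (n <= 3 * #|dt_cut s t|)%N.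
  have [s [t Gst]] : exists s t, G s t.
    have [x [y [_ _ xy]]] := card_gt1P n_gt1.
    have dxy : val (dt_map D y) != val (dt_map D x).
      by rewrite (inj_eq val_inj) (inj_eq (bij_inj (dt_mapP D))) eq_sym.
    have [_ conn _] := treeG.
    have [z Gxz _] := connect_first_step dxy (conn (val (dt_map D x)) _).
    by exists (val (dt_map D x)), z.
  have cover : [set: V] \subset (dt_cut s t :|: dt_cut t s)%SET.
    apply/subsetP => x _; rewrite in_setU !mem_dt_cut.
    exact: tree_edge_sides.
  have := leq_trans (subset_leq_card cover) (leq_card_setU _ _).
  rewrite cardsT -/n => le_n.
  have [le_st | lt_st] := leqP n (3 * #|dt_cut s t|); first by exists s, t.
  by exists t, s; split; [rewrite adj_sym | lia].
pose heavy (e : dt_node D * dt_node D) :=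
  G e.1 e.2 && (n <= 3 * #|dt_cut e.1 e.2|)%N.
have heavy0 : heavy (s0, t0) by rewrite /heavy Gst0.
case: (arg_minnP (fun e => #|side G e.1 e.2|) heavy0) => -[s t].
rewrite /heavy /= => /andP[Gst big_st] min_st.
exists s, t; split => //; rewrite leqNgt; apply/negP => huge.
have inner_s : ~~ is_leaf G s.
  by apply/negP => /card_dt_cut_leaf/(_ Gst); lia.
have [y /andP[Gsy yt] le_cut] := card_dt_cut_split inner_s Gst.
have /min_st/= : heavy (y, s) by rewrite /heavy/= adj_sym Gsy/=; lia.
by rewrite leqNgt (proper_card (side_proper treeG Gsy yt)).
Qed.
End BalancedEdge.

(** * Decomposition trees exist *)

Section SymmetricRelation.
Variables (T : finType) (e : rel T).
Hypotheses (sym_e : symmetric e) (irr_e : irreflexive e).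

Lemma simple_adj_rel : simple_adj [set u : T * T | e u.1 u.2]%SET.
Proof.
apply/andP; split; last by apply/forallP => x; rewrite inE /= irr_e.
by apply/forallP => x; apply/forallP => y; rewrite !inE /= sym_e.
Qed.

Definition graph_of_rel := SGraph simple_adj_rel.

Lemma graph_of_relE (x y : T) : graph_of_rel x y = e x y.
Proof. by rewrite /adj inE. Qed.
End SymmetricRelation.

(** A graph in which every vertex but the first one has exactly one smaller
    neighbour. *)
Section ParentTree.
Variables (N : nat) (p : nat -> nat).
Hypothesis p_lt : forall i, (0 < i)%N -> (p i < i)%N.

Definition parent_rel : rel 'I_N.+1 := fun i j =>
  (0 < i)%N && (p i == j) || (0 < j)%N && (p j == i).

Lemma parent_rel_sym : symmetric parent_rel.
Proof. by move=> i j; rewrite /parent_rel orbC. Qed.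

Lemma parent_rel_irr : irreflexive parent_rel.
Proof.
move=> i; rewrite /parent_rel orbb; apply/negP => /andP[/p_lt lt_i /eqP eq_i].
by rewrite eq_i ltnn in lt_i.
Qed.

Definition parent_graph := graph_of_rel parent_rel_sym parent_rel_irr.

Lemma parent_graphE i j : parent_graph i j = parent_rel i j.
Proof. exact: graph_of_relE. Qed.

Lemma parent_graph_le i j : parent_graph i j -> (j <= i)%N -> nat_of_ord j = p i.
Proof.
rewrite parent_graphE => /orP[/andP[_ /eqP //]|/andP[/p_lt lt_j /eqP <-]].
by rewrite leqNgt lt_j.
Qed.

(** Both neighbours on a cycle of its largest vertex would be its parent. *)
Lemma parent_graph_tree : is_tree parent_graph.
Proof.
split; first by rewrite card_ord.
- have to0 : forall i : 'I_N.+1, connect parent_graph i ord0.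
    move=> i; have [m le_m] := ubnP (nat_of_ord i); elim: m i le_m => // m IHm i le_m.
    have [i0|i0] := posnP i; first by rewrite (_ : i = ord0) ?connect0//; apply/val_inj.
    have lt_pi : (p i < i)%N by apply: p_lt.
    have lt_pN : (p i < N.+1)%N by apply: ltn_trans (ltn_ord i).
    apply: (@connect_trans _ _ (Ordinal lt_pN)).
      by apply: connect1; rewrite parent_graphE /parent_rel i0 eqxx.
    by apply: IHm => /=; apply: leq_trans lt_pi _.
  have sym_conn : connect_sym parent_graph.
    by apply: sym_connect_sym => i j; rewrite !parent_graphE parent_rel_sym.
  by move=> i j; apply: connect_trans (to0 i) _; rewrite sym_conn.
- move=> c /andP[cyc_c uniq_c]; rewrite ltnNge; apply/negP => size_c.
  have [m0 m0c] : exists m0, m0 \in c.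
    by case: c size_c {cyc_c uniq_c} => // x ? _; exists x; rewrite mem_head.
  case: (arg_maxnP (fun i : 'I_N.+1 => nat_of_ord i) m0c) => m mc max_m.
  have [i s def_s] := rot_to mc.
  move: cyc_c uniq_c size_c; rewrite -(rot_cycle i) -(rot_uniq i) -(size_rot i) def_s.
  have le_m y : y \in s -> (y <= m)%N.
    move=> ys; have yc : y \in c by rewrite -(mem_rot i) def_s inE ys orbT.
    exact: max_m.
  case: s le_m {def_s} => [//|y s] le_m; elim/last_ind: s => [//|s z _] in le_m *.
  rewrite /= rcons_path last_rcons => /and3P[Gmy _ Gzm] /and3P[_ y_notin _] _.
  have ym : nat_of_ord y = p m by apply: parent_graph_le Gmy (le_m _ (mem_head _ _)).
  have zm : nat_of_ord z = p m.
    apply: parent_graph_le; first by rewrite adj_sym.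
    by apply: le_m; rewrite inE mem_rcons mem_head orbT.
  by rewrite (_ : y = z) ?mem_rcons ?mem_head// in y_notin; apply: val_inj; rewrite /= ym.
Qed.
End ParentTree.

(** The caterpillar: the odd numbers up to [2k + 1] form a path starting at [0],
    and each positive even number hangs off its predecessor. *)
Definition caterpillar_parent (i : nat) : nat := i - 1 - odd i.

Lemma caterpillar_parent_lt i : (0 < i)%N -> (caterpillar_parent i < i)%N.
Proof. by rewrite /caterpillar_parent; lia. Qed.

Definition caterpillar (k : nat) : sgraph 'I_(k.*2.+2) :=
  parent_graph k.*2.+1 caterpillar_parent_lt.

Lemma caterpillar_leaf (k : nat) (i : 'I_(k.*2.+2)) :
  ~~ odd i || (i == k.*2.+1 :> nat) -> deg (caterpillar k) i = 1%N.
Proof.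
move=> leaf_i; pose j : 'I_k.*2.+2 :=
  inord (if (i == 0 :> nat)%N then 1%N else caterpillar_parent i).
rewrite -(card1 j); apply: eq_card => t; rewrite !inE parent_graphE /parent_rel.
rewrite -val_eqE /= inordK; last first.
  by case: ifP => //; have := ltn_ord i; rewrite /caterpillar_parent; lia.
move: (ltn_ord i) (ltn_ord t) leaf_i; rewrite /caterpillar_parent.
move: (nat_of_ord i) (nat_of_ord t) => {j}i {}t lt_i lt_t.
by case: i lt_i => [|i] lt_i leaf_i /=; lia.
Qed.

Lemma caterpillar_inner (k : nat) (i : 'I_(k.*2.+2)) :
  odd i && (i != k.*2.+1 :> nat) -> deg (caterpillar k) i = 3%N.
Proof.
move=> inner_i; have lt_i := ltn_ord i.
pose s : seq 'I_k.*2.+2 := [:: inord (caterpillar_parent i); inord i.+1; inord i.+2].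
have val_s : map val s = [:: caterpillar_parent i; i.+1; i.+2].
  by rewrite /= !inordK// /caterpillar_parent; lia.
have uniq_s : uniq s.
  by rewrite -(map_inj_uniq val_inj) val_s /= !inE /caterpillar_parent; lia.
rewrite -[RHS]/(size s) -(card_uniqP uniq_s); apply: eq_card => t.
rewrite -(mem_map val_inj) val_s !inE /= parent_graphE /parent_rel.
by have := ltn_ord t; rewrite /caterpillar_parent; move: inner_i; lia.
Qed.

Lemma is_leaf_caterpillar (k : nat) (i : 'I_(k.*2.+2)) :
  is_leaf (caterpillar k) i = ~~ odd i || (i == k.*2.+1 :> nat).
Proof.
rewrite /is_leaf; have [/caterpillar_leaf -> //|] := boolP (_ || _).
by rewrite negb_or negbK => /caterpillar_inner ->.
Qed.

Lemma caterpillar_cubic (k : nat) (i : 'I_(k.*2.+2)) :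
  ~~ is_leaf (caterpillar k) i -> deg (caterpillar k) i = 3%N.
Proof.
by rewrite is_leaf_caterpillar negb_or negbK => /caterpillar_inner.
Qed.

Definition caterpillar_node (k : nat) (i : 'I_k.+2) : 'I_(k.*2.+2) :=
  inord (minn i.*2 k.*2.+1).

Lemma val_caterpillar_node k (i : 'I_k.+2) :
  caterpillar_node i = minn i.*2 k.*2.+1 :> nat.
Proof. by rewrite inordK//; lia. Qed.

Lemma caterpillar_node_leaf (k : nat) (i : 'I_k.+2) :
  is_leaf (caterpillar k) (caterpillar_node i).
Proof.
by rewrite is_leaf_caterpillar val_caterpillar_node; have := ltn_ord i; lia.
Qed.

Lemma caterpillar_node_bij (k : nat) :
  bijective (fun i : 'I_k.+2 =>
    exist (fun t => is_leaf (caterpillar k) t) _ (caterpillar_node_leaf i)).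
Proof.
exists (fun t : {t | is_leaf (caterpillar k) t} => inord (uphalf (val t))).
  move=> i; apply: val_inj; rewrite /= inordK val_caterpillar_node; have := ltn_ord i; lia.
move=> [t leaf_t]; apply: val_inj; apply: val_inj.
rewrite /= val_caterpillar_node; move: leaf_t; rewrite is_leaf_caterpillar.
have := ltn_ord t => lt_t leaf_t.
by rewrite inordK; lia.
Qed.

Lemma decomp_tree_exists (n : nat) : (1 < n)%N -> inhabited (decomp_tree 'I_n).
Proof.
case: n => [|[|k]] // _; constructor.
exact (@DecompTree _ _ (caterpillar k) (parent_graph_tree _ caterpillar_parent_lt)
  (@caterpillar_cubic k) _ (caterpillar_node_bij k)).
Qed.

(** * Regular graphs exist *)

Section Circulant.
Variables (m : nat) (S : {set 'I_m.+1}).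
Hypotheses (S0 : 0 \notin S) (SN : forall j, (- j \in S) = (j \in S)).

Lemma circulant_sym : symmetric (fun x y : 'I_m.+1 => y - x \in S).
Proof. by move=> x y; rewrite -SN opprB. Qed.

Lemma circulant_irr : irreflexive (fun x y : 'I_m.+1 => y - x \in S).
Proof. by move=> x; rewrite subrr (negbTE S0). Qed.

Definition circulant := graph_of_rel circulant_sym circulant_irr.

Lemma deg_circulant x : deg circulant x = #|S|.
Proof.
rewrite -(card_imset S (addrI x)); apply: eq_card => y.
rewrite inE graph_of_relE; apply/idP/imsetP => [yx|[j jS ->]].
  by exists (y - x) => //; rewrite addrC subrK.
by rewrite [x + j]addrC addrK.
Qed.
End Circulant.

Lemma card_ord_interval (n a b : nat) :
  (b <= n)%N -> #|[set j : 'I_n | a <= j < b]%N| = (b - a)%N.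
Proof.
move=> bn; rewrite -sum1dep_card.
rewrite -(big_mkord (fun j => a <= j < b)%N (fun=> 1%N)).
have <- : (\sum_(a <= j < b) 1 = b - a)%N by rewrite sum_nat_const_nat muln1.
by rewrite [RHS](big_nat_widenl _ 0)// [RHS](big_nat_widen _ _ n).
Qed.

Lemma regular_graph_exists (d n : nat) :
  (d < n)%N -> ~~ odd (d * n) -> (0 < #|regular_graphs d n|)%N.
Proof.
case: n => // m dm even_dn.
have [h hd] : exists h, d = (odd d + h.*2)%N by exists d./2; rewrite odd_double_half.
have [c hc] : exists c, m.+1 = (odd m.+1 + c.*2)%N.
  by exists m.+1./2; rewrite odd_double_half.
have even_n : odd d -> odd m.+1 = false.
  by move=> od; move: even_dn; rewrite oddM od => /negbTE.
(* For odd [d] the involution [c] completes the [h] pairs [j], [-j]. *)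
pose S := [set j : 'I_m.+1 | (1 <= j < h.+1)%N]
  :|: [set j : 'I_m.+1 | (m.+1 - h <= j < m.+1)%N]
  :|: [set j : 'I_m.+1 | (c <= j < c + odd d)%N].
have S0 : 0 \notin S.
  rewrite !inE /=; case: (odd d) hd even_n; case: (odd m.+1) hc; lia.
have SN j : (- j \in S) = (j \in S).
  rewrite !inE /=.
  have [j0|j0] := posnP j.
    by rewrite j0 subn0 modnn.
  have jn := ltn_ord j.
  rewrite modn_small; last by lia.
  case: (odd d) hd even_n; case: (odd m.+1) hc; lia.
have disj (P Q : pred 'I_m.+1) : (forall j, P j -> ~~ Q j) ->
    #|[set j | P j] :|: [set j | Q j]| = (#|[set j | P j]| + #|[set j | Q j]|)%N.
  move=> PQ; rewrite cardsU (_ : _ :&: _ = set0) ?cards0 ?subn0//.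
  by apply/setP => j; rewrite !inE; apply/negbTE/negP => /andP[/PQ/negbTE ->].
have joinS : [set j : 'I_m.+1 | (1 <= j < h.+1)%N]
    :|: [set j : 'I_m.+1 | (m.+1 - h <= j < m.+1)%N]
    = [set j : 'I_m.+1 | (1 <= j < h.+1) || (m.+1 - h <= j < m.+1)]%N.
  by apply/setP => j; rewrite !inE.
have cardS : #|S| = d.
  rewrite /S joinS disj; last first.
    by move=> j; case: (odd d) hd even_n; case: (odd m.+1) hc; lia.
  rewrite -joinS disj; last by move=> j; lia.
  rewrite !card_ord_interval; first by lia.
  - lia.
  - lia.
  - case: (odd d) hd even_n; case: (odd m.+1) hc; lia.
apply/card_gt0P; exists (circulant S0 SN).
by rewrite inE; apply/forallP => x; rewrite deg_circulant cardS.
Qed.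

(** * Switching two edges across a cut *)

Lemma graph_ext (V : finType) (G H : sgraph V) : G =2 H -> G = H.
Proof.
move=> eqGH; apply: val_inj; apply/setP => -[x y].
exact: eqGH.
Qed.

Definition arcs (V : finType) (G : sgraph V) (X Y : {set V}) : {set V * V} :=
  [set u in setX X Y | G u.1 u.2].

Lemma mem_arcs (V : finType) (G : sgraph V) (X Y : {set V}) x y :
  ((x, y) \in arcs G X Y) = [&& x \in X, y \in Y & G x y].
Proof. by rewrite inE in_setX -andbA. Qed.

Section Switch.
Variables (V : finType).
Implicit Types (G : sgraph V) (t : (V * V) * (V * V)).

(** The edges of the closed walk [a1 a2 b2 b1], where [t = ((a1, a2), (b1, b2))].
    Dropping the loops of degenerate walks makes [switch t] a total operation on
    graphs, which as a symmetric difference is an involution. *)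
Definition quad t : rel V := fun x y =>
  let q := [:: t.1; t.2; (t.1.1, t.2.1); (t.1.2, t.2.2)] in
  (x != y) && (((x, y) \in q) || ((y, x) \in q)).

Lemma quad_sym t : symmetric (quad t).
Proof. by move=> x y; rewrite /quad eq_sym orbC. Qed.

Lemma switch_sym t G : symmetric (fun x y => G x y (+) quad t x y).
Proof. by move=> x y; rewrite adj_sym quad_sym. Qed.

Lemma switch_irr t G : irreflexive (fun x y => G x y (+) quad t x y).
Proof. by move=> x; rewrite adj_irr /quad eqxx. Qed.

Definition switch t G : sgraph V := graph_of_rel (switch_sym t G) (switch_irr t G).

Lemma switchE t G x y : switch t G x y = G x y (+) quad t x y.
Proof. exact: graph_of_relE. Qed.

Lemma switchK t : involutive (switch t).
Proof.
move=> G; apply: graph_ext => x y.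
by rewrite !switchE -addbA addbb addbF.
Qed.

Lemma card_toggle_pair (N : pred V) (p q : V) :
  N p -> ~~ N q -> #|[pred y | N y (+) ((y == p) || (y == q))]| = #|N|.
Proof.
move=> Np Nq; have pq : p != q by apply: contraNneq Nq => <-.
rewrite (cardD1 p N) (cardD1 q [pred y | _]) [p \in N]Np.
rewrite inE (negbTE Nq) eqxx orbT /=; congr (_ + _)%N.
apply: eq_card => y; rewrite !inE [y \in N]unfold_in.
have [->|yp] := eqVneq y p; first by rewrite pq Np.
by have [->|yq] := eqVneq y q; rewrite ?(negbTE Nq) ?addbF.
Qed.

Variables (A B : {set V}).
Hypothesis disjAB : [disjoint A & B].

Definition switchable G : {set (V * V) * (V * V)} :=
  [set t in setX (arcs G A A) (arcs G B B) |
    ~~ G t.1.1 t.2.1 && ~~ G t.1.2 t.2.2].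

(** The quadruples whose switching may have produced [G]. *)
Definition unswitchable G : {set (V * V) * (V * V)} :=
  [set t | ((t.1.1, t.2.1) \in arcs G A B) && ((t.1.2, t.2.2) \in arcs G A B)].

Lemma disj_neq a b : a \in A -> b \in B -> (a == b) = false.
Proof.
by move=> aA bB; apply: contraTF bB => /eqP <-; rewrite (disjointFr disjAB aA).
Qed.

Section Switchable.
Variables (G : sgraph V) (a1 a2 b1 b2 : V).
Hypothesis Ht : ((a1, a2), (b1, b2)) \in switchable G.
Let t := ((a1, a2), (b1, b2)).

Lemma switchableP : [/\ [/\ a1 \in A, a2 \in A, b1 \in B & b2 \in B],
   G a1 a2, G b1 b2, ~~ G a1 b1 & ~~ G a2 b2].
Proof.
move: Ht; rewrite inE in_setX !mem_arcs /= => /andP[/andP[]].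
by move=> /and3P[-> -> ->] /and3P[-> -> ->] /andP[-> ->].
Qed.

Lemma switchable_neq :
  ((a1 == a2) = false) * ((b1 == b2) = false) * ((a2 == a1) = false) *
  ((b2 == b1) = false) * ((a1 == b1) = false) * ((a1 == b2) = false) *
  ((a2 == b1) = false) * ((a2 == b2) = false) * ((b1 == a1) = false) *
  ((b1 == a2) = false) * ((b2 == a1) = false) * ((b2 == a2) = false).
Proof.
have [[a1A a2A b1B b2B] Ga Gb _ _] := switchableP.
have a12 : (a1 == a2) = false by apply: contraTF Ga => /eqP ->; rewrite adj_irr.
have b12 : (b1 == b2) = false by apply: contraTF Gb => /eqP ->; rewrite adj_irr.
have flip (u v : V) : (u == v) = false -> (v == u) = false by rewrite eq_sym.
have ab11 := disj_neq a1A b1B; have ab12 := disj_neq a1A b2B.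
have ab21 := disj_neq a2A b1B; have ab22 := disj_neq a2A b2B.
by do !split=> //; apply: flip.
Qed.

(** Every vertex of the 4-cycle loses one neighbour and gains another. *)
Lemma deg_switch x : deg (switch t G) x = deg G x.
Proof.
have [_ Ga Gb Gab1 Gab2] := switchableP.
have row p q : G x p -> ~~ G x q ->
    (forall y, quad t x y = (y == p) || (y == q)) -> deg (switch t G) x = deg G x.
  move=> Gp Gq Hq; rewrite /deg -(card_toggle_pair Gp Gq); apply: eq_card => y.
  by rewrite !inE switchE Hq.
have [xa1|xa1] := eqVneq x a1.
  rewrite {}xa1 in row *; apply: (row a2 b1) => // y.
  rewrite /quad !inE !xpair_eqE /= eqxx !switchable_neq !andbF !orbF /=.
  by have [->|_] := eqVneq y a1; rewrite ?eqxx ?switchable_neq// eq_sym.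
have [xa2|xa2] := eqVneq x a2.
  rewrite {}xa2 in row *; apply: (row a1 b2); rewrite // 1?adj_sym// => y.
  rewrite /quad !inE !xpair_eqE /= eqxx !switchable_neq !andbF !orbF /=.
  by have [->|_] := eqVneq y a2; rewrite ?eqxx ?switchable_neq// !andbT orbC.
have [xb1|xb1] := eqVneq x b1.
  rewrite {}xb1 in row *; apply: (row b2 a1); rewrite // 1?adj_sym// => y.
  rewrite /quad !inE !xpair_eqE /= eqxx !switchable_neq !andbF !orbF /=.
  by have [->|_] := eqVneq y b1; rewrite ?eqxx ?switchable_neq// !andbT.
have [xb2|xb2] := eqVneq x b2.
  rewrite {}xb2 in row *; apply: (row b1 a2); rewrite 1?adj_sym// => y.
  rewrite /quad !inE !xpair_eqE /= eqxx !switchable_neq !andbF !orbF /=.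
  by have [->|_] := eqVneq y b2; rewrite ?eqxx ?switchable_neq// !andbT.
apply: eq_card => y; rewrite !inE switchE /quad !inE !xpair_eqE /=.
by rewrite (negbTE xa1) (negbTE xa2) (negbTE xb1) (negbTE xb2) !andbF addbF.
Qed.

Lemma arcs_switch :
  arcs (switch t G) A B = (a1, b1) |: ((a2, b2) |: arcs G A B).
Proof.
have [[a1A a2A b1B b2B] Ga Gb Gab1 Gab2] := switchableP.
apply/setP => -[x y]; rewrite !in_setU1 !mem_arcs switchE /quad !inE !xpair_eqE /=.
have [xA|xA] := boolP (x \in A); last first.
  by rewrite /= orbF; apply/esym/negbTE; rewrite negb_or !negb_and; apply/andP; split;
    apply/orP; left; apply: contraNneq xA => ->.
have [yB|yB] := boolP (y \in B); last first.
  by rewrite /= orbF; apply/esym/negbTE; rewrite negb_or !negb_and; apply/andP; split;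
    apply/orP; right; apply: contraNneq yB => ->.
rewrite (disj_neq xA yB) (disj_neq xA b1B) (disj_neq xA b2B).
rewrite [y == a1]eq_sym [y == a2]eq_sym (disj_neq a1A yB) (disj_neq a2A yB).
rewrite !andbF /= !orbF.
have [/andP[/eqP-> /eqP->]|_] := boolP ((x == a1) && (y == b1)).
  by rewrite ?switchable_neq (negbTE Gab1) ?eqxx.
have [/andP[/eqP-> /eqP->]|_] := boolP ((x == a2) && (y == b2)).
  by rewrite ?switchable_neq (negbTE Gab2) ?eqxx ?orbT.
by rewrite addbF.
Qed.

Lemma card_arcs_switch : #|arcs (switch t G) A B| = (#|arcs G A B|).+2.
Proof.
have [[a1A a2A b1B b2B] Ga Gb Gab1 Gab2] := switchableP.
have a12 : (a1 == a2) = false by apply: contraTF Ga => /eqP ->; rewrite adj_irr.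
rewrite arcs_switch !cardsU1 in_setU1 !mem_arcs xpair_eqE a12.
by rewrite (negbTE Gab1) (negbTE Gab2) !andbF.
Qed.
End Switchable.

Definition regular_crossing (d k : nat) : {set sgraph V} :=
  [set G | [forall x, deg G x == d] && (#|arcs G A B| == k)].

Lemma card_unswitchable G : #|unswitchable G| = (#|arcs G A B| ^ 2)%N.
Proof.
pose h (t : (V * V) * (V * V)) := ((t.1.1, t.2.1), (t.1.2, t.2.2)).
have hK : involutive h by case=> -[a1 a2] [b1 b2].
rewrite -mulnn -cardsX -(card_imset _ (can_inj hK)); apply: eq_card => t.
case: t => -[a1 b1] [a2 b2]; apply/imsetP/setXP => [[u uG [-> -> -> ->]]|[t1G t2G]].
  by apply/andP; rewrite inE in uG.
by exists ((a1, a2), (b1, b2)); rewrite // inE t1G.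
Qed.

Section Degree.
Variables (G : sgraph V) (d : nat).
Hypothesis degG : forall x, deg G x = d.

Lemma card_arcsC (X Y : {set V}) : #|arcs G X Y| = #|arcs G Y X|.
Proof.
pose h (u : V * V) := (u.2, u.1).
have hK : involutive h by case.
rewrite -(card_imset _ (can_inj hK)); apply: eq_card => -[y x].
rewrite mem_arcs; apply/imsetP/idP => [[[u v]]|].
  by rewrite mem_arcs => /and3P[uX vY Guv] [-> ->]; rewrite vY uX adj_sym.
by case/and3P=> yY xX Gyx; exists (x, y); rewrite // mem_arcs xX yY adj_sym.
Qed.

Lemma card_arcsT (X : {set V}) : #|arcs G X setT| = (d * #|X|)%N.
Proof.
rewrite -sum1_card mulnC -sum_nat_const.
rewrite (eq_bigl (fun u => (u.1 \in X) && G u.1 u.2)); last first.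
  by move=> -[x y]; rewrite mem_arcs inE.
rewrite -(pair_big_dep (mem X) (fun x y => G x y) (fun _ _ => 1%N)) /=.
by apply: eq_bigr => x _; rewrite sum1_card; apply: degG.
Qed.

Lemma card_arcs1T (x : V) : #|arcs G [set x] setT| = d.
Proof. by rewrite card_arcsT cards1 muln1. Qed.

(** The arcs from [X] to the vertices outside [X] and [Y] are counted at their
    ends. *)
Lemma card_arcs_inner (X Y : {set V}) :
  (d * #|X| <= #|arcs G X X| + #|arcs G X Y| + d * #|~: (X :|: Y)|)%N.
Proof.
rewrite -!card_arcsT [X in (_ <= _ + X)%N]card_arcsC.
apply: leq_trans (leq_trans (leq_card_setU _ _) (leq_add (leq_card_setU _ _) (leqnn _))).
apply/subset_leq_card/subsetP => -[x y]; rewrite !in_setU !mem_arcs !inE /=.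
by move=> /andP[-> ->]; case: (y \in X); case: (y \in Y).
Qed.

(** Two edges inside the sides fail to be switchable only if their first ends, or
    their second ends, form a crossing edge; each such pair of ends leaves
    [d ^ 2] choices for the two other ends. *)
Lemma card_switchable :
  (#|arcs G A A| * #|arcs G B B|
     <= #|switchable G| + 2 * (#|arcs G A B| * d ^ 2))%N.
Proof.
pose bad1 := \bigcup_(c in arcs G A B)
  setX (arcs G [set c.1] setT) (arcs G [set c.2] setT).
pose bad2 := \bigcup_(c in arcs G A B)
  setX (arcs G setT [set c.1]) (arcs G setT [set c.2]).
have card_bad1 : (#|bad1| <= #|arcs G A B| * d ^ 2)%N.
  apply: leq_trans (card_bigcup_le _ _) _; rewrite -sum_nat_const.
  by apply: leq_sum => c _; rewrite cardsX !card_arcs1T mulnn.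
have card_bad2 : (#|bad2| <= #|arcs G A B| * d ^ 2)%N.
  apply: leq_trans (card_bigcup_le _ _) _; rewrite -sum_nat_const.
  by apply: leq_sum => c _; rewrite cardsX card_arcsC card_arcs1T card_arcsC card_arcs1T mulnn.
apply: (@leq_trans (#|switchable G| + #|bad1| + #|bad2|)%N); last first.
  by rewrite mul2n -addnn -addnA leq_add2l leq_add.
rewrite -cardsX.
apply: leq_trans (leq_trans (leq_card_setU _ _) (leq_add (leq_card_setU _ _) (leqnn _))).
apply/subset_leq_card/subsetP => -[[a1 a2] [b1 b2]] tAB.
rewrite !in_setU inE tAB /=; move: tAB.
rewrite in_setX !mem_arcs => /andP[/and3P[a1A a2A Ga] /and3P[b1B b2B Gb]].
have [Gab1|_] := boolP (G a1 b1).
  apply/orP; left; apply/orP; right; apply/bigcupP; exists (a1, b1).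
    by rewrite mem_arcs a1A b1B.
  by rewrite in_setX !mem_arcs !inE !eqxx Ga Gb.
have [Gab2|//] := boolP (G a2 b2).
apply/orP; right; apply/bigcupP; exists (a2, b2).
  by rewrite mem_arcs a2A b2B.
by rewrite in_setX !mem_arcs !inE !eqxx Ga Gb.
Qed.
End Degree.

(** For a fixed quadruple switching is injective, so it maps the pairs (graph with
    [k] crossing edges, switchable quadruple) injectively to the pairs (graph with
    [k + 2] crossing edges, quadruple whose two pairs of ends cross). *)
Lemma double_count_switchings (d k F c : nat) :
  (forall G, G \in regular_crossing d k -> F <= c * #|switchable G|)%N ->
  (F * #|regular_crossing d k|
     <= c * (k.+2 ^ 2 * #|regular_crossing d k.+2|))%N.
Proof.
move=> geF.
apply: (@leq_trans (c * \sum_(G in regular_crossing d k) \sum_(t in switchable G) 1)%N).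
  rewrite mulnC -sum_nat_const big_distrr /=.
  by apply: leq_sum => G /geF; rewrite sum1_card.
rewrite leq_mul2l; apply/orP; right; rewrite [leqRHS]mulnC.
apply: (@leq_trans (\sum_(G in regular_crossing d k.+2)
                      \sum_(t in unswitchable G) 1)%N); last first.
  rewrite -sum_nat_const; apply: leq_sum => G; rewrite inE => /andP[_ /eqP cardG].
  by rewrite sum1_card card_unswitchable cardG.
rewrite (exchange_big_dep predT)//= [leqRHS](exchange_big_dep predT)//=; apply: leq_sum => t _.
rewrite !sum1dep_card -(card_imset _ (can_inj (switchK t))).
apply/subset_leq_card/subsetP => H /imsetP[G]; rewrite inE => /andP[GR tG] {H}->.
move: t tG => [[a1 a2] [b1 b2]] tG.
have [degG cardG] : (forall x, deg G x = d) /\ #|arcs G A B| = k.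
  by move: GR; rewrite inE => /andP[/forallP degG /eqP ->]; split=> // x; apply/eqP.
rewrite inE; apply/andP; split.
  rewrite inE card_arcs_switch// cardG eqxx andbT.
  by apply/forallP => x; rewrite deg_switch// degG.
by rewrite inE arcs_switch// !in_setU1 !eqxx orbT.
Qed.

(** The numerical content of the expansion: as [d >= 3], at least
    [5 / 2 * (a - k) + a / 4] ordered edges remain inside each side when [2k]
    edges cross the cut, and the excess over [5 / 2 * (a - k)] pays for the
    quadruples that are not switchable. *)
Lemma switching_numbers (d a b s k x y : nat) :
  (3 <= d)%N -> (12 * s <= a)%N -> (12 * s <= b)%N -> (64 * d ^ 2 <= a)%N ->
  (64 * d ^ 2 <= b)%N -> (k < a)%N -> (k < b)%N ->
  (d * a <= x + k.*2 + d * s)%N -> (d * b <= y + k.*2 + d * s)%N ->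
  (25 * ((a - k) * (b - k)) + 16 * (k * d ^ 2) <= 4 * (x * y))%N.
Proof.
move=> d3 sa sb da db ka kb hx hy.
have arc_bound c z : (12 * s <= c)%N -> (k < c)%N ->
    (d * c <= z + k.*2 + d * s)%N -> (10 * (c - k) + c <= 4 * z)%N.
  move=> sc kc; have le_sc : (s <= c)%N by lia.
  rewrite -{1}(subnK le_sc) mulnDr leq_add2r => hz.
  have : (3 * (c - s) <= d * (c - s))%N by rewrite leq_mul2r d3 orbT.
  lia.
have {hx sa} hx := arc_bound a x sa ka hx.
have {hy sb} hy := arc_bound b y sb kb hy.
have hk : (k * (64 * d ^ 2) <= a * b)%N by apply: leq_mul; rewrite // ltnW.
have := leq_mul hx hy; move: (a - k)%N (b - k)%N => u v; rewrite mulnACA.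
rewrite mulnDl !mulnDr; lia.
Qed.

Lemma switching_step (d k : nat) :
  let a := #|A| in let b := #|B| in let s := #|~: (A :|: B)| in
  (3 <= d)%N -> (12 * s <= a)%N -> (12 * s <= b)%N -> (64 * d ^ 2 <= a)%N ->
  (64 * d ^ 2 <= b)%N ->
  (25 * ((a - k) * (b - k)) * #|regular_crossing d k.*2|
     <= 16 * k.+1 ^ 2 * #|regular_crossing d k.+1.*2|)%N.
Proof.
move=> a b s d3 sa sb da db.
have [ak|ak] := leqP a k; first by rewrite (eqP (ak : a - k == 0)%N) !mul0n.
have [bk|bk] := leqP b k; first by rewrite (eqP (bk : b - k == 0)%N) muln0.
have geF G : G \in regular_crossing d k.*2 ->
    (25 * ((a - k) * (b - k)) <= 4 * #|switchable G|)%N.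
  rewrite inE => /andP[/forallP regG /eqP crossG].
  have degG x : deg G x = d by apply/eqP.
  have := card_arcs_inner degG A B; rewrite crossG => hA.
  have := card_arcs_inner degG B A; rewrite (card_arcsC G B) crossG setUC => hB.
  have := switching_numbers d3 sa sb da db ak bk hA hB.
  have := card_switchable degG; rewrite crossG; lia.
have := double_count_switchings geF.
have -> : (k.*2.+2 ^ 2 = 4 * k.+1 ^ 2)%N by rewrite -doubleS -mul2n expnMn.
by rewrite !mulnA.
Qed.

(** The ratios [(a - k) * (b - k) / k.+1 ^ 2] of the successive steps multiply up
    to ['C(a, K) * 'C(b, K)]. *)
Lemma card_no_crossing_le (d K : nat) :
  let a := #|A| in let b := #|B| in let s := #|~: (A :|: B)| in
  (3 <= d)%N -> (12 * s <= a)%N -> (12 * s <= b)%N -> (64 * d ^ 2 <= a)%N ->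
  (64 * d ^ 2 <= b)%N ->
  (25 ^ K * ('C(a, K) * 'C(b, K)) * #|regular_crossing d 0|
     <= 16 ^ K * #|[set G : sgraph V | [forall x, deg G x == d]]|)%N.
Proof.
move=> a b s d3 sa sb da db.
have step : (25 ^ K * ('C(a, K) * 'C(b, K)) * #|regular_crossing d 0|
     <= 16 ^ K * #|regular_crossing d K.*2|)%N.
  elim: K => [|K IHK]; first by rewrite !bin0 !mul1n.
  rewrite -(leq_pmul2l (_ : 0 < K.+1 ^ 2)%N) ?expn_gt0//.
  have stepK := switching_step K d3 sa sb da db.
  have binS c : (K.+1 * 'C(c, K.+1) = (c - K) * 'C(c, K))%N.
    by rewrite mul_bin_left.
  apply: (@leq_trans (25 * ((a - K) * (b - K)) * (16 ^ K * #|regular_crossing d K.*2|))%N).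
    apply: leq_trans (leq_mul (leqnn _) IHK); rewrite eq_leq//.
    rewrite -mulnn !expnS.
    rewrite [RHS](_ : _ = 25 * 25 ^ K * (((a - K) * 'C(a, K)) * ((b - K) * 'C(b, K)))
      * #|regular_crossing d 0|)%N; last by ring.
    by rewrite -!binS; move: 'C(a, K.+1) 'C(b, K.+1) => x y; ring.
  rewrite (expnS 16) mulnCA; apply: leq_trans (leq_mul (leqnn _) stepK) _.
  by rewrite eq_leq//; move: #|regular_crossing d K.+1.*2| => z; ring.
apply: leq_trans step _; rewrite leq_mul2l; apply/orP; right.
by apply/subset_leq_card/subsetP => G; rewrite !inE => /andP[].
Qed.

End Switch.

(** * Binomial estimates *)

(** [K] maximises ['C(a, K) * 'C(b, K)]: it carries at least the average of
    Vandermonde's sum, and comparison with the next term locates it. *)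
Lemma large_Vandermonde_term (a b : nat) :
  exists K, ('C(a + b, a) <= a.+1 * ('C(a, K) * 'C(b, K)))%N
         /\ (a * b <= (a + b + 2) * K + 1)%N.
Proof.
pose f k := ('C(a, k) * 'C(b, k))%N.
case: (arg_maxnP (fun k : 'I_a.+1 => f k) (isT : xpredT (ord0 : 'I_a.+1))) => K _ maxK.
exists K; split.
  rewrite -binomial.Vandermonde (reindex_inj rev_ord_inj) /=.
  rewrite -[X in (_ <= X * _)%N]card_ord -sum_nat_const; apply: leq_sum => i _.
  have le_ia : (i <= a)%N by rewrite -ltnS.
  by rewrite subSS subKn// bin_sub//; apply: maxK.
have fK0 : (0 < f K)%N by apply: leq_trans (maxK ord0 isT); rewrite /f !bin0.
have le_next : (f K.+1 <= f K)%N.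
  have [lt_Ka|le_aK] := ltnP K a; last by rewrite /f bin_small.
  exact: (maxK (Ordinal (lt_Ka : K.+1 < a.+1)%N) isT).
have step : (K.+1 * K.+1 * f K.+1 = (a - K) * (b - K) * f K)%N.
  by rewrite /f mulnACA !mul_bin_left mulnACA.
have : ((a - K) * (b - K) <= K.+1 * K.+1)%N.
  by rewrite -(leq_pmul2r fK0) -step leq_mul2l le_next orbT.
move: fK0; rewrite /f muln_gt0 !bin_gt0 => /andP[Ka Kb].
move: maxK step le_next => _ _ _; move: (nat_of_ord K) Ka Kb => k ka kb.
by rewrite -(subnK ka) -(subnK kb) !addnK; move: (a - k)%N (b - k)%N => u v; nia.
Qed.

(** Weighting each set by the inverse of the number of sets of its size makes every
    size contribute [1]. *)
Lemma sum_inv_bin (F : numFieldType) (T : finType) (X : {set T}) :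
  \sum_(A : {set T} | A \subset X) ('C(#|X|, #|A|)%:R^-1 : F) = #|X|.+1%:R.
Proof.
rewrite (partition_big (fun A : {set T} => inord #|A| : 'I_#|X|.+1) predT)//=.
rewrite -[RHS]mulr1 -[#|X|.+1 in RHS]card_ord mulr_natl -sumr_const.
apply: eq_bigr => k _; pose draws := [set A : {set T} | A \subset X & #|A| == k].
rewrite (eq_bigl (mem draws)); last first.
  move=> A; rewrite !inE; case: (boolP (A \subset X)) => //= /subset_leq_card AX.
  by rewrite -val_eqE /= inordK.
rewrite (eq_bigr (fun=> 'C(#|X|, k)%:R^-1)); last first.
  by move=> A Adraws; have : A \in draws by []; rewrite inE => /andP[_ /eqP ->].
rewrite sumr_const cards_draws -[_^-1 *+ _]mulr_natl mulfV// pnatr_eq0 -lt0n bin_gt0.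
by rewrite -ltnS.
Qed.

Lemma sum_pow_card (F : comNzRingType) (T : finType) (x : F) :
  \sum_(A : {set T}) x ^+ #|A| = (1 + x) ^+ #|T|.
Proof.
rewrite [1 + x]addrC -[RHS]prodr_const bigA_distr /=; apply: eq_bigr => A _.
by rewrite -[LHS]prodr_const big_mkcond.
Qed.

Section Decay.
Variable F : realFieldType.

Lemma Bernoulli (x : F) (n : nat) : -1 <= x -> 1 + x * n%:R <= (1 + x) ^+ n.
Proof.
move=> x_ge; elim: n => [|n IHn]; first by rewrite mulr0 addr0 expr0.
rewrite exprS; apply: (@le_trans _ _ ((1 + x) * (1 + x * n%:R))).
  have : 0 <= x ^+ 2 * n%:R by rewrite mulr_ge0// sqr_ge0.
  by rewrite -natr1; lra.
by rewrite ler_wpM2l//; lra.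
Qed.

(** The common base in which all exponential factors are expressed: it is close
    enough to [1] for Bernoulli's inequality to give each comparison. *)
Definition decay : F := 100 / 101.

Lemma decay_gt0 : 0 < decay. Proof. by rewrite /decay; lra. Qed.

Lemma decayX_ge0 (n : nat) : 0 <= decay ^+ n.
Proof. by rewrite exprn_ge0// ltW// decay_gt0. Qed.

Lemma decay_le1 : decay <= 1. Proof. by rewrite /decay; lra. Qed.

Lemma decayX_le (m n : nat) : (m <= n)%N -> decay ^+ n <= decay ^+ m.
Proof. by apply: ler_wiXn2l; rewrite ?decay_le1 ?ltW ?decay_gt0. Qed.

Lemma decayX_ge : 16 / 25 <= decay ^+ 36.
Proof.
have -> : decay = 1 + - (1 / 101) by rewrite /decay; lra.
apply: le_trans (Bernoulli _ _); lra.
Qed.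

Lemma decayX_le_inv (n : nat) : decay ^+ n * (1 + n%:R / 100) <= 1.
Proof.
have /(Bernoulli n) : -1 <= (1 / 100 : F) by lra.
have -> : 1 + 1 / 100 = decay^-1 by rewrite /decay; field.
rewrite exprVn mulrAC mul1r => le_inv.
by rewrite mulrC -ler_pdivlMr ?exprn_gt0 ?decay_gt0// mul1r.
Qed.

Lemma decayX_small : decay ^+ 700 <= 1 / 100.
Proof.
have half : decay ^+ 100 <= 1 / 2.
  by have := decayX_le_inv 100; move: (decay ^+ 100) => x; lra.
have -> : 700%N = (100 * 7)%N by lia.
rewrite exprM; apply: (@le_trans _ _ ((1 / 2) ^+ 7)).
  by rewrite lerXn2r// nnegrE; [exact: decayX_ge0 | lra].
by rewrite !exprS expr0; lra.
Qed.

(** Exponential decay beats a cube: [decay ^+ n] is at most the cube of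
    [decay ^+ (n %/ 3)], to which Bernoulli's inequality applies. *)
Lemma decayX_cube (n : nat) : decay ^+ n * n.+1%:R ^+ 3 <= 300 ^+ 3.
Proof.
pose u := (n %/ 3)%N.
apply: (@le_trans _ _ (decay ^+ (u * 3) * (300 * (1 + u%:R / 100)) ^+ 3)).
  apply: ler_pM; rewrite ?decayX_ge0 ?exprn_ge0//.
    by apply: decayX_le; rewrite /u; lia.
  rewrite lerXn2r ?nnegrE ?mulr_ge0 ?addr_ge0 ?divr_ge0//.
  have : n.+1%:R <= (3 * u + 3)%:R :> F by rewrite ler_nat /u; lia.
  rewrite natrD natrM; have := ler0n F u; lra.
have u0 := ler0n F u.
rewrite exprM -exprMn mulrCA exprMn.
rewrite -[leRHS]mulr1 -[X in _ <= _ * X](expr1n _ 3).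
apply: ler_wpM2l; first exact/exprn_ge0/ler0n.
rewrite lerXn2r ?nnegrE ?decayX_le_inv//.
by rewrite mulr_ge0 ?decayX_ge0// addr_ge0// divr_ge0.
Qed.
End Decay.

(** * Few regular graphs have a small separator *)

Section UnionBound.
Variables (F : realFieldType) (V : finType) (d : nat).
Let n := #|V|.
Hypothesis d3 : (3 <= d)%N.
Hypothesis n_large : (300 * d ^ 2 <= n)%N.

Definition regular : {set sgraph V} := [set G | [forall x, deg G x == d]].

Definition balanced (A : {set V}) : bool :=
  (n <= 3 * #|A|)%N && (3 * #|A| <= 2 * n)%N.

Definition boundary (G : sgraph V) (A : {set V}) : {set V} := nbhd G A :&: ~: A.

Definition badly_separated : {set sgraph V} :=
  [set G in regular | [exists A, balanced A && (700 * #|boundary G A| <= n)%N]].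

(** Vandermonde's term of index [K >= n / 12] absorbs the binomial of the union
    bound over [A], and leaves [(16 / 25) ^ K <= decay ^+ (3 * n)]. *)
Lemma card_separated_le (S A : {set V}) :
  A \subset ~: S -> balanced A -> (700 * #|S| <= n)%N ->
  #|regular_crossing A (~: (A :|: S)) d 0|%:R
    <= #|regular|%:R * (n.+1%:R * decay F ^+ (3 * n)) * 'C(#|~: S|, #|A|)%:R^-1.
Proof.
move=> AS /andP[An nA] Sn; set B := ~: (A :|: S).
have disjAB : [disjoint A & B].
  by rewrite disjoints_subset setCK subsetUl.
have defS : ~: (A :|: B) = S.
  apply/setP => x; rewrite !inE; have := subsetP AS x; rewrite inE.
  by case: (x \in A) => [/(_ isT)/negbTE -> //|_]; case: (x \in S).
have cardB : (#|A| + #|B| = #|~: S|)%N.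
  rewrite -(cardsID A (~: S)) (setIidPr AS); congr (_ + _)%N.
  by apply: eq_card => x; rewrite !inE negb_or.
have cardS : (#|~: S| + #|S| = n)%N by rewrite addnC cardsC.
have d9 : (9 <= d ^ 2)%N by rewrite (leq_mul d3 d3).
have := @card_no_crossing_le _ A B disjAB d; rewrite /= defS => bound.
have [K [termK leK]] := large_Vandermonde_term #|A| #|B|.
have {bound} bound := bound K d3 ltac:(lia) ltac:(lia) ltac:(lia) ltac:(lia).
(* Otherwise [#|A| * #|B|] would be about [n ^ 2 / 12] at most, while the sides
   have at least [n / 3] and [3 * n / 10] vertices. *)
have le_nK : (n <= 12 * K)%N.
  rewrite leqNgt; apply/negP => lt_Kn.
  have A3 : (n <= 3 * #|A|)%N by [].
  have B10 : (3 * n <= 10 * #|B|)%N by lia.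
  have := leq_mul A3 B10; rewrite mulnACA => ab.
  have : ((#|A| + #|B| + 2) * (12 * K) <= (n + 2) * n)%N.
    by rewrite leq_mul//; lia.
  have : (2700 * n <= n * n)%N by rewrite leq_mul2r; lia.
  by rewrite mulnCA; move: leK ab; rewrite !mulnA; nia.
rewrite ler_pdivlMr ?ltr0n ?bin_gt0; last by lia.
have nat_bound : (25 ^ K * ('C(#|~: S|, #|A|) * #|regular_crossing A B d 0|)
    <= 16 ^ K * (#|regular| * n.+1))%N.
  apply: (@leq_trans (25 ^ K *
    (n.+1 * ('C(#|A|, K) * 'C(#|B|, K)) * #|regular_crossing A B d 0|))%N).
    rewrite leq_mul2l leq_mul2r; apply/orP; right; apply/orP; right.
    by rewrite -cardB (leq_trans termK)// leq_mul2r; apply/orP; right; lia.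
  have scale (x c y z w m : nat) :
      (x * c * y <= z * w -> x * (m * c * y) <= z * (w * m))%N.
    by move=> le_xz; have := leq_mul le_xz (leqnn m); lia.
  exact: scale bound.
have q36 : (16 / 25) ^+ K <= decay F ^+ (3 * n).
  apply: (@le_trans _ _ ((decay F ^+ 36) ^+ K)).
    by rewrite lerXn2r ?nnegrE ?decayX_ge ?decayX_ge0//; lra.
  by rewrite -exprM; apply: decayX_le; lia.
have -> : #|regular_crossing A B d 0|%:R * 'C(#|~: S|, #|A|)%:R =
   ('C(#|~: S|, #|A|) * #|regular_crossing A B d 0|)%:R :> F.
  by rewrite natrM mulrC.
apply: (@le_trans _ _ ((16 / 25) ^+ K * (#|regular| * n.+1)%:R)).
  rewrite expr_div_n mulrAC ler_pdivlMr ?exprn_gt0//.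
  by rewrite mulrC -!natrX -!natrM ler_nat.
by rewrite mulrC natrM -!mulrA !ler_wpM2l.
Qed.

(** Give each vertex of [S] the weight [1 / 100]: the total weight of all sets is
    [(101 / 100) ^ n], while a set of at most [n / 700] vertices weighs at least
    [decay ^+ n]. *)
Lemma card_small_sets :
  #|[set S : {set V} | 700 * #|S| <= n]%N|%:R * decay F ^+ (2 * n) <= 1.
Proof.
rewrite mulr_natl -sumr_const.
apply: (@le_trans _ _ (decay F ^+ n * \sum_(S : {set V}) (1 / 100) ^+ #|S|)).
  rewrite big_distrr /= [leLHS]big_mkcond /=; apply: ler_sum => S _.
  rewrite inE; case: ifP => Sn; last by rewrite mulr_ge0 ?decayX_ge0 ?exprn_ge0//; lra.
  rewrite mul2n -addnn exprD ler_wpM2l ?decayX_ge0//.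
  apply: le_trans (decayX_le F Sn) _; rewrite exprM.
  by rewrite lerXn2r ?nnegrE ?decayX_small ?decayX_ge0//; lra.
rewrite sum_pow_card -exprMn -/n.
by rewrite (_ : _ * _ = 1) ?expr1n// /decay; lra.
Qed.

(** A union bound over the separators [S] and the sides [A]: of the factor
    [decay ^+ (3 * n)], two thirds pay for the choice of [S], and the weights
    [1 / 'C(#|~: S|, #|A|)] sum to at most [n + 1] over [A]. *)
Lemma card_badly_separated :
  #|badly_separated|%:R <= #|regular|%:R * (n.+1%:R ^+ 2 * decay F ^+ n).
Proof.
pose small (S : {set V}) := (700 * #|S| <= n)%N.
pose N0 (S A : {set V}) := #|regular_crossing A (~: (A :|: S)) d 0|.
pose sides (S A : {set V}) := (A \subset ~: S) && balanced A.
have cover :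
    (#|badly_separated| <= \sum_(S | small S) \sum_(A | sides S A) N0 S A)%N.
  rewrite pair_big_dep /=; apply: leq_trans (card_bigcup_le _ _).
  apply/subset_leq_card/subsetP => G; rewrite inE.
  move=> /andP[regG /existsP[A /andP[balA smallA]]].
  apply/bigcupP; exists (boundary G A, A) => /=.
    rewrite /small smallA /sides balA andbT /=.
    by apply/subsetP => x xA; rewrite !inE xA andbF.
  rewrite inE; rewrite inE in regG; rewrite regG /= cards_eq0 -subset0.
  apply/subsetP => -[x y]; rewrite mem_arcs => /and3P[xA yB Gxy].
  move: yB; rewrite !inE => /norP[yA /negP[]]; rewrite yA andbT.
  by apply/existsP; exists x; rewrite xA.
pose w : F := #|regular|%:R * (n.+1%:R * decay F ^+ (3 * n)).
apply: (@le_trans _ _ (\sum_(S | small S) (w * n.+1%:R))).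
  apply: (@le_trans _ _ (\sum_(S | small S) \sum_(A | sides S A) (N0 S A)%:R)).
    move: cover; rewrite -(ler_nat F) => /le_trans; apply.
    by rewrite natr_sum; apply: ler_sum => S _; rewrite natr_sum.
  apply: ler_sum => S smallS.
  apply: (@le_trans _ _ (\sum_(A | sides S A) (w * 'C(#|~: S|, #|A|)%:R^-1))).
    by apply: ler_sum => A /andP[AS balA]; apply: card_separated_le.
  rewrite -big_distrr /= ler_wpM2l ?mulr_ge0 ?decayX_ge0//.
  apply: (@le_trans _ _ (\sum_(A : {set V} | A \subset ~: S) 'C(#|~: S|, #|A|)%:R^-1)).
    by rewrite big_mkcondr /=; apply: ler_sum => A _; case: ifP; rewrite // invr_ge0.
  by rewrite sum_inv_bin ler_nat ltnS max_card.
have in_small S : small S = (S \in [set S | small S]) by rewrite inE.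
rewrite (eq_bigl _ _ in_small).
rewrite sumr_const -[leLHS]mulr_natr.
have := card_small_sets; set m := #|_|%:R => le1.
rewrite [leLHS](_ : _ =
    #|regular|%:R * (n.+1%:R ^+ 2 * decay F ^+ n) * (m * decay F ^+ (2 * n))).
  by rewrite ler_piMr// mulr_ge0// mulr_ge0 ?decayX_ge0// exprn_ge0.
rewrite /w (_ : 3 * n = n + 2 * n)%N ?exprD; last by lia.
by ring.
Qed.
End UnionBound.

(** * Almost all regular graphs *)

Lemma boolw_ge (R : realType) (d n : nat) (G : sgraph 'I_n) :
  (0 < d)%N -> (1 < n)%N -> (forall x, deg G x = d) ->
  (forall A : {set 'I_n}, balanced A -> (n < 700 * #|boundary G A|)%N) ->
  1 / 700 * (n%:R / d%:R) <= boolw R G.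
Proof.
move=> d0 n1 degG expG; apply: lb_le_inf.
  by have [D] := decomp_tree_exists n1; exists (dt_boolw R G D); exists D.
move=> _ [D ->]; have [|s [t [Gst le_n ge_n]]] := balanced_edge D; first by rewrite card_ord.
have /expG exp_cut : balanced (dt_cut s t) by rewrite /balanced le_n ge_n.
have leG : forall x, (deg G x <= d)%N by move=> x; rewrite degG.
apply: le_trans (le_trans (cutbool_ge R (dt_cut s t) d0 leG) _).
  rewrite mulrA ler_wpM2r ?invr_ge0//.
  have := ltnW exp_cut; rewrite -(ler_nat R) natrM.
  by rewrite -/(boundary _ _); lra.
exact: (@le_bigmax_cond _ R _ 0 (s, t) (fun e => dt_graph D e.1 e.2)
  (fun e => cutbool R G (dt_cut e.1 e.2))).
Qed.

Local Open Scope classical_set_scope.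

Theorem theorem3 (R : realType) :
  exists2 c : R, 0 < c &
    forall d : nat, (3 <= d)%N ->
      (fun n : nat =>
         regular_pr R d (fun G : sgraph 'I_n => c * (n%:R / d%:R) <= boolw R G))
        @ within [set n : nat | ~~ odd (d * n)] \oo --> (1 : R).
Proof.
exists (1 / 700); first by lra.
move=> d d3.
set f := (fun n : nat => _).
have bounds n : (300 * d ^ 2 <= n)%N -> ~~ odd (d * n) ->
    1 - 300 ^+ 3 * harmonic n <= f n <= 1.
  move=> n_large even_dn; rewrite /f /regular_pr.
  set good := [set G in _ | _]%SET.
  have dn : (d < n)%N by have := leq_mul d3 (leqnn d); rewrite -mulnn in n_large; lia.
  have reg0 : (0 < #|regular_graphs d n|)%N := regular_graph_exists dn even_dn.
  have n_large' : (300 * d ^ 2 <= #|'I_n|)%N by rewrite card_ord.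
  have := card_badly_separated R d3 n_large'.
  rewrite card_ord -/(regular_graphs d n) => le_bad.
  have good_sub : (good \subset regular_graphs d n).
    by apply/subsetP => G; rewrite inE => /andP[].
  have le_good : (#|regular_graphs d n| <= #|good| + #|badly_separated 'I_n d|)%N.
    apply: leq_trans (leq_card_setU _ _).
    apply/subset_leq_card/subsetP => G regG; rewrite in_setU.
    have [badG|notbad] := boolP (G \in badly_separated 'I_n d); apply/orP; [by right|left].
    rewrite inE regG; apply: boolw_ge; [lia|lia| |].
      by move=> x; move: regG; rewrite inE => /forallP/(_ x)/eqP.
    move=> A balA; rewrite ltnNge; apply: contra notbad => smallA.
    rewrite inE regG; apply/existsP; exists A; rewrite balA card_ord.
    exact: smallA.
  have T0 : 0 < #|regular_graphs d n|%:R :> R by rewrite ltr0n.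
  rewrite ler_pdivlMr// ler_pdivrMr// mul1r ler_nat subset_leq_card// andbT.
  have n0 : 0 < n.+1%:R :> R by rewrite ltr0n.
  have le_harmonic : n.+1%:R ^+ 2 * decay R ^+ n <= 300 ^+ 3 * harmonic n.
    by rewrite ler_pdivlMr// mulrAC -exprSr mulrC decayX_cube.
  have le_bad' := le_trans le_bad (ler_wpM2l (ltW T0) le_harmonic).
  move: le_good; rewrite -(ler_nat R) natrD.
  by move: le_bad'; move: (300 ^+ 3 * _) => u; lra.
have lim0 : (fun n => 1 - 300 ^+ 3 * harmonic n) @ \oo --> (1 : R).
  rewrite -[X in _ --> X](_ : 1 - 300 ^+ 3 * 0 = 1); last by rewrite mulr0 subr0.
  by apply: cvgB; [exact: cvg_cst | apply: cvgMl_tmp; exact: cvg_harmonic].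
apply: (@squeeze_cvgr _ _ _ _ (fun n => 1 - 300 ^+ 3 * harmonic n) (fun=> 1)).
- by rewrite near_withinE; exists (300 * d ^ 2)%N.
- exact: cvg_within_filter lim0.
- exact: cvg_cst.
Qed.
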